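(* Let $N\ge 2$ be an integer, let $\delta\ge 0$ and $\lambda\ge 0$, and set $$\epsilon_N:=\frac{N^2(\delta+2)}{N(N-1)(\delta+2)-2\delta}-1 .$$ Then $\epsilon_N\to 0$ as $N\to\infty$ (for fixed $\delta$), and if $$\lambda<(1+\epsilon_N)\,2\delta,$$ then the continuous-time Markov chain $X^N=(X^N_1,\dots,X^N_N)$ on $\mathbb{N}^N$ (the small jump model with parameters $N,\delta,\lambda$) is transient.
   Context: $\mathbb{N}=\{0,1,2,\dots\}$. The small jump model with $N$ particles and parameters $\delta\ge0$, $\lambda\ge0$ is the continuous-time Markov chain $X^N=(X^N_1,\dots,X^N_N)$ on $\mathbb{N}^N$ in which, for each $i=1,\dots,N$, the coordinate $X^N_i$ makes the following jumps (one coordinate moving at a time). If $X^N_i>0$, it jumps to $X^N_i+1$ at rate $1+\delta$ and to $X^N_i-1$ at rate $1+\lambda\,\frac1N\sum_{k=1}^N\mathbf 1(X^N_k<X^N_i)$. If $X^N_i=0$, the only allowed jump is to $X^N_i+1=1$, at rate $1+\delta$. *)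

(* Defs.v *)
From HB Require Import structures.
From mathcomp Require Import all_boot all_order all_algebra.
From mathcomp Require Import all_classical all_reals all_analysis.

Set Implicit Arguments.
Unset Strict Implicit.
Unset Printing Implicit Defensive.

Import Order.TTheory GRing.Theory Num.Theory.
Import numFieldNormedType.Exports.

Local Open Scope classical_set_scope.
Local Open Scope ring_scope.

(** Continuous-time Markov chains on a countable state space [S], given by
    jump rates [q x y], with the convention [q x x = 0]. *)

(* Meant for rates whose sum out of each state is finite: [fine] sends [+oo]
   to [0]. *)
Definition exit_rate (R : realType) (S : countType) (q : S -> S -> R) (x : S)
    : R :=
  fine (\esum_(y in [set y | y != x]) (q x y)%:E).

Definition jump_time (R : realType) (T : Type) (H : nat -> T -> R) (n : nat)
    (w : T) : R :=
  \sum_(k < n) H k w.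

(* [X] under [P] is the (minimal) chain with jump rates [q] started at [x0]:
   its jump chain [Y] is a discrete-time Markov chain with transition
   probabilities [q x y / exit_rate q x] and, given [Y], the holding times
   [H k] are independent exponentials of parameters [exit_rate q (Y k)].
   [X t w = None] means that [X] has exploded by time [t].  States with zero
   exit rate are not covered by this definition. *)
Definition chain_from (R : realType) (S : countType) (q : S -> S -> R)
    (d : measure_display) (T : measurableType d) (x0 : S)
    (P : probability T R) (X : R -> T -> option S) : Prop :=
  exists (Y : nat -> T -> S) (H : nat -> T -> R),
  [/\ forall n y, measurable [set w | Y n w = y],
      forall n, measurable_fun [set: T] (H n),
      forall n w, 0 < H n w,
      forall (n : nat) (y : nat -> S) (t : nat -> R),
        (forall k, 0 <= t k) ->
        P [set w | (forall k, (k <= n.+1)%N -> Y k w = y k) /\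
                   (forall k, (k <= n)%N -> t k < H k w)] =
        ((y 0%N == x0)%:R *
         \prod_(k < n.+1) (q (y k) (y k.+1) / exit_rate q (y k) *
                           expR (- (exit_rate q (y k) * t k))))%:E
    & forall t w y, 0 <= t ->
        X t w = Some y <->
        exists n, jump_time H n w <= t < jump_time H n.+1 w /\ Y n w = y].

(* The chain as a family of laws [P x] indexed by the starting state. *)
Definition markov_chain (R : realType) (S : countType) (q : S -> S -> R)
    (d : measure_display) (T : measurableType d)
    (P : S -> probability T R) (X : R -> T -> option S) : Prop :=
  forall x, chain_from q x (P x) X.

(* Every state [x] is transient: almost surely under [P x], the set of times
   spent at [x] is bounded. *)
Definition transient (R : realType) (S : countType)
    (d : measure_display) (T : measurableType d)
    (P : S -> probability T R) (X : R -> T -> option S) : Prop :=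
  forall x, {ae P x, forall w, has_ubound [set t | 0 <= t /\ X t w = Some x]}.

Definition incr (N : nat) (x : {ffun 'I_N -> nat}) (i : 'I_N)
    : {ffun 'I_N -> nat} :=
  [ffun k => if k == i then (x k).+1 else x k].

Definition decr (N : nat) (x : {ffun 'I_N -> nat}) (i : 'I_N)
    : {ffun 'I_N -> nat} :=
  [ffun k => if k == i then (x k).-1 else x k].

(* At most one summand is nonzero, since the states [incr x i] and (when
   [0 < x i]) [decr x i] are pairwise distinct; in particular the rate vanishes
   for [y = x]. *)
Definition small_jump_rate (R : realType) (N : nat) (delta lambda : R)
    (x y : {ffun 'I_N -> nat}) : R :=
  \sum_(i < N)
    ((if y == incr x i then 1 + delta else 0) +
     (if (0 < x i)%N && (y == decr x i)
      then 1 + lambda * (N%:R^-1 * \sum_(k < N) (x k < x i)%N%:R)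
      else 0)).

Definition eps (R : realType) (delta : R) (N : nat) : R :=
  N%:R ^+ 2 * (delta + 2) /
    (N%:R * (N%:R - 1) * (delta + 2) - 2 * delta) - 1.

(* Main.v *)
Require Import Defs.
From HB Require Import structures.
From mathcomp Require Import all_boot all_order all_algebra.
From mathcomp Require Import all_classical all_reals all_analysis.
From mathcomp Require Import zify ring lra.

Set Implicit Arguments.
Unset Strict Implicit.
Unset Printing Implicit Defensive.

Import Order.TTheory GRing.Theory Num.Theory.
Import numFieldNormedType.Exports.

Local Open Scope classical_set_scope.
Local Open Scope ring_scope.

(** Transience follows from a function with bounded jumps whose drift is
    bounded below by a positive constant.  The obvious candidate, the sum of
    the coordinates, has drift at least
      [N * delta - lambda / N * #{pairs of particles at distinct heights}],
    which in the worst case, when no two particles are tied, is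
    [N * delta - lambda * (N - 1) / 2]; this only reaches
    [lambda < 2 * delta * N / (N - 1)].  The remaining margin comes from the
    lowest particle: when it is alone it feels no downward push, so that the
    minimum drifts up at rate at least [delta].  Hence take
      [f x = \sum_i x i + c * min x,  c = lambda / (N * (2 + delta))].
    If a single particle sits at the minimum, the correction adds [c * delta].
    If [m >= 2] particles do, the minimum falls at rate at most [m], but the
    [m * (m - 1) / 2] tied pairs among them give back [lambda / N] each, and [c]
    is the largest constant for which this still leaves a gain of [c * delta] when
    [m = 2].  So [drift_ge] bounds the drift of [f] below by
      [N * delta - lambda * (N - 1) / 2 + c * delta]
    at every state, and the hypothesis on [lambda] says exactly that this
    number is positive ([drift_bound_gt0]).

    The jumps of [f] and the exit rates are bounded, so a second order
    expansion of the exponential shows that for small [theta] the function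
    [g = exp (- theta * f)] is contracted by the jump chain: its conditional
    expectation after one jump is at most [rho * g] for some [rho < 1]
    ([exp_lyapunov_contraction]).  Iterating, the probability of being at [z]
    after [n] jumps is at most [rho ^+ n * g x0 / g z] ([hit_le]), which is
    summable; by Borel-Cantelli the jump chain visits [z] finitely often, and
    the time spent at [z] is therefore bounded
    ([geometric_drift_transient]). *)

(** * Countable sums *)

Lemma measure_esum_fibre (R : realType) (d : measure_display)
    (T : measurableType d) (mu : {measure set T -> \bar R}) (S : countType)
    (Y : T -> S) (A : set T) :
  measurable A -> (forall s, measurable [set w | Y w = s]) ->
  mu A = \esum_(s in [set: S]) mu (A `&` [set w | Y w = s]).
Proof.
move=> mA mY.
(* [pickle] indexes the fibres by [nat]; unused indices give empty sets. *)
pose F n := A `&` [set w | pickle (Y w) = n].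
have Fpickle s : F (pickle s) = A `&` [set w | Y w = s].
  apply/seteqP; split=> w [Aw] /= Yw; split=> //; last by rewrite /= Yw.
  exact: (pcan_inj (@pickleK S)) Yw.
have F0 n : ~ (exists s : S, pickle s = n) -> F n = set0.
  move=> nex; apply/seteqP; split=> // w [_ /= Yn].
  by apply: nex; exists (Y w).
have mF n : measurable (F n).
  have [[s <-]|/F0 ->] := pselect (exists s : S, pickle s = n).
    by rewrite Fpickle; exact: measurableI.
  exact: measurable0.
have tF : trivIset setT F.
  by move=> i j _ _ [w [[_ /= <-] [_ /= <-]]].
have -> : mu A = mu (\bigcup_n F n).
  congr (mu _); apply/seteqP; split=> w; last by case=> n _ [].
  by move=> Aw; exists (pickle (Y w)).
rewrite measure_bigcup//.
transitivity (\esum_(n in [set: nat]) mu (F n)).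
  rewrite nneseries_esum; last by [].
  by congr esum; apply/seteqP; split=> n //= _; rewrite in_setT.
have -> : \esum_(n in [set: nat]) mu (F n) =
    \esum_(n in pickle @` [set: S]) mu (F n).
  rewrite [RHS]esum_mkcond; apply: eq_esum => n _.
  case: ifPn => // /negP; rewrite inE => nn.
  by rewrite F0 ?measure0// => -[s sn]; apply: nn; exists s.
rewrite esum_image; last by move=> s t _ _ /(pcan_inj (@pickleK S)).
by apply: eq_esum => s _; rewrite Fpickle.
Qed.

Lemma esum_scale_le (R : realType) (S : choiceType) (C B : R) (h : S -> R) :
  0 <= C -> (\esum_(s in [set: S]) (h s)%:E <= B%:E)%E ->
  (\esum_(s in [set: S]) (C * h s)%:E <= (C * B)%:E)%E.
Proof.
move=> C0 hB; apply: ge_ereal_sup => _ [X [finX XT] <-].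
have hX : (\sum_(s \in X) (h s)%:E <= B%:E)%E.
  by apply: le_trans hB; apply: ereal_sup_ubound; exists X.
rewrite fsbig_finite//= in hX; rewrite fsbig_finite//=.
rewrite sumEFin lee_fin in hX.
by rewrite sumEFin lee_fin -mulr_sumr; apply: (ler_wpM2l C0 hX).
Qed.

Lemma esum_point (R : realType) (S : choiceType) (D : set S) (b : bool)
    (a : S) (v : R) :
  0 <= v -> (b -> D a) ->
  \esum_(y in D) (if b && (y == a) then v else 0)%:E = (if b then v else 0)%:E.
Proof.
move=> v0; case: b => [/(_ isT) Da|_]; last by rewrite esum1.
rewrite -[RHS](@esum_set1 _ _ a (fun=> v%:E))//.
have -> : [set a] = D `&` [set a] by apply/esym/setIidr => y ->.
rewrite esum_mkcondr; apply: eq_esum => y _.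
have -> : (y \in [set a]) = (y == a) by apply/idP/eqP; rewrite inE.
by case: eqVneq.
Qed.

(** * A transience criterion for jump chains *)

Section supermartingale_criterion.
Variables (R : realType) (S : countType) (q : S -> S -> R).
Variables (g : S -> R) (rho : R).
Hypothesis q_ge0 : forall x y, 0 <= q x y.
Hypothesis exit_ge0 : forall x, 0 <= exit_rate q x.
Hypothesis g_gt0 : forall x, 0 < g x.
Hypothesis rho_gt0 : 0 < rho.
Hypothesis rho_lt1 : rho < 1.
Hypothesis drift : forall x,
  (\esum_(y in [set: S]) (q x y / exit_rate q x * g y)%:E <= (rho * g x)%:E)%E.
Variables (d : measure_display) (T : measurableType d) (P : probability T R).
Variables (x0 : S) (Y : nat -> T -> S) (H : nat -> T -> R).
Hypothesis mY : forall n y, measurable [set w | Y n w = y].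
Hypothesis H_gt0 : forall n w, 0 < H n w.
Hypothesis law : forall (n : nat) (y : nat -> S) (t : nat -> R),
  (forall k, 0 <= t k) ->
  P [set w | (forall k, (k <= n.+1)%N -> Y k w = y k) /\
             (forall k, (k <= n)%N -> t k < H k w)] =
  ((y 0%N == x0)%:R *
   \prod_(k < n.+1) (q (y k) (y k.+1) / exit_rate q (y k) *
                     expR (- (exit_rate q (y k) * t k))))%:E.

Definition path_weight (n : nat) (y : nat -> S) : R :=
  (y 0%N == x0)%:R * \prod_(k < n) (q (y k) (y k.+1) / exit_rate q (y k)).

Definition history (n : nat) (y : nat -> S) : set T :=
  [set w | forall k, (k <= n)%N -> Y k w = y k].

Lemma path_weight_ge0 n y : 0 <= path_weight n y.
Proof.
rewrite mulr_ge0// prodr_ge0// => k _.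
by rewrite mulr_ge0// invr_ge0.
Qed.

Lemma measurable_history n y : measurable (history n y).
Proof.
rewrite (_ : history n y =
    \bigcap_(k in [set k | (k <= n)%N]) [set w | Y k w = y k]).
  by apply: bigcap_measurableType => k _; exact: mY.
by apply/seteqP; split.
Qed.

(** The holding times are positive, so requiring them to exceed [0] leaves the
    law of the jump chain alone. *)
Lemma historyE n y : P (history n.+1 y) = (path_weight n.+1 y)%:E.
Proof.
have := @law n y (fun=> 0) (fun=> lexx 0).
under eq_bigr do rewrite mulr0 oppr0 expR0 mulr1.
move=> <-; congr (P _); apply/seteqP; split=> w /=; last by case.
by move=> h; split=> // k _; exact: H_gt0.
Qed.

Definition extend_path (n : nat) (y : nat -> S) (s : S) : nat -> S :=
  fun k => if (k <= n)%N then y k else s.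

Lemma history_extend n y s :
  history n.+1 (extend_path n y s) = history n y `&` [set w | Y n.+1 w = s].
Proof.
apply/seteqP; split=> w /=.
  move=> h; split=> [k kn|].
    by rewrite (h k (leqW kn)) /extend_path kn.
  by rewrite (h n.+1 (leqnn _)) /extend_path ltnn.
move=> [h1 h2] k; rewrite leq_eqVlt => /orP[/eqP ->|].
  by rewrite h2 /extend_path ltnn.
by rewrite ltnS => kn; rewrite h1// /extend_path kn.
Qed.

Lemma path_weight_extend n y s :
  path_weight n.+1 (extend_path n y s) =
  path_weight n y * (q (y n) s / exit_rate q (y n)).
Proof.
rewrite /path_weight big_ord_recr/= mulrA /extend_path leqnn ltnn /=.
congr (_ * _ * _); apply: eq_bigr => k _.
by rewrite (ltnW (ltn_ord k)) ltn_ord.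
Qed.

(** The Markov property is used one step at a time: summing over the position
    at step [n.+1] extends the prescribed history by one step, whose weight the
    law of the chain gives, and [drift] absorbs the sum over that position.
    The induction is on the number of steps left, which avoids summing over
    paths.  The case [n + j = 0] is left out because the law is only given for
    histories with at least one jump. *)
Lemma history_hit_le z j n y : (0 < n + j)%N ->
  (P (history n y `&` [set w | Y (n + j) w = z]) <=
   (path_weight n y * (rho ^+ j * g (y n) / g z))%:E)%E.
Proof.
elim: j n y => [|j IH] n y nj.
  rewrite addn0 in nj *; rewrite expr0 mul1r.
  have [yz|/eqP yz] := pselect (y n = z).
    rewrite yz divff ?gt_eqF// mulr1; case: n nj {yz} => // n _.
    rewrite -historyE; apply: le_measure; rewrite ?inE.
    - by apply: measurableI => //; exact: measurable_history.
    - exact: measurable_history.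
    - by move=> w [].
  rewrite (_ : _ `&` _ = set0) ?measure0.
    by rewrite lee_fin mulr_ge0 ?path_weight_ge0// divr_ge0// ltW.
  apply/seteqP; split=> // w [/(_ n (leqnn n)) /= -> /= yzn].
  by rewrite yzn eqxx in yz.
rewrite (@measure_esum_fibre _ _ _ _ _ (Y n.+1)); first last.
- exact: mY.
- by apply: measurableI; [exact: measurable_history|exact: mY].
have -> : path_weight n y * (rho ^+ j.+1 * g (y n) / g z) =
    (path_weight n y * (rho ^+ j / g z)) * (rho * g (y n)).
  by rewrite exprS; ring.
apply: le_trans (esum_scale_le _ (drift (y n))); last first.
  rewrite mulr_ge0 ?path_weight_ge0// divr_ge0 ?ltW//.
  exact: exprn_gt0.
apply: le_esum => s _.
rewrite setIAC -history_extend addnS -addSn.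
apply: le_trans (IH _ _ _) _ => //.
rewrite path_weight_extend /extend_path ltnn lee_fin le_eqVlt; apply/orP; left.
by apply/eqP; ring.
Qed.

Lemma hit_le z j :
  (P [set w | Y j.+1 w = z] <= (rho ^+ j.+1 * g x0 / g z)%:E)%E.
Proof.
rewrite (@measure_esum_fibre _ _ _ _ _ (Y 0)) //.
apply: (@le_trans _ _ (\esum_(s in [set: S])
   (if s \in [set x0] then (rho ^+ j.+1 * g x0 / g z)%:E else 0%E))).
  apply: le_esum => s _.
  have := @history_hit_le z j.+1 0 (fun=> s) isT.
  rewrite add0n /path_weight big_ord0 mulr1 setIC.
  have -> : history 0 (fun=> s) = [set w | Y 0%N w = s].
    apply/seteqP; split=> w; first by move=> /(_ 0%N isT).
    by move=> /= h k; rewrite leqn0 => /eqP ->.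
  move=> /le_trans; apply.
  case: eqVneq => [->|sx]; first by rewrite mul1r mem_set.
  by rewrite mul0r; case: ifP => // _; rewrite lee_fin divr_ge0 ?ltW//
    mulr_gt0// exprn_gt0.
rewrite -esum_mkcond esum_set1// lee_fin divr_ge0 ?ltW// mulr_gt0//.
exact: exprn_gt0.
Qed.

(** Borel-Cantelli, with the geometric series as majorant. *)
Lemma ae_finitely_many_visits z :
  {ae P, forall w, exists n, forall k, (n <= k)%N -> Y k w <> z}.
Proof.
pose F k := [set w | Y k.+1 w = z].
have mF k : measurable (F k) by exact: mY.
have F0 : P (lim_sup_set F) = 0%E.
  apply: lim_sup_set_cvg0 => //.
  pose a := rho * g x0 / g z.
  have a0 : 0 <= a by rewrite divr_ge0 ?ltW// mulr_gt0.
  apply: (@le_lt_trans _ _ (a / (1 - rho))%:E); last by rewrite ltry.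
  apply: lime_le; first by apply: is_cvg_nneseries.
  apply: nearW => n.
  apply: (@le_trans _ _ (series (geometric a rho) n)%:E); last first.
    by rewrite lee_fin geometric_le_lim// ger0_norm// ltW.
  rewrite /series/= -sumEFin; apply: lee_sum => k _.
  apply: le_trans (hit_le _ _) _; rewrite lee_fin le_eqVlt; apply/orP; left.
  by apply/eqP; rewrite /a exprS; ring.
exists (lim_sup_set F); split=> //.
  apply: bigcapT_measurable => n; apply: bigcup_measurable => k _; exact: mF.
move=> w; rewrite /= /lim_sup_set/= => nw n _.
apply: contrapT => nF; apply: nw; exists n.+1 => -[//|k] nk Yz.
by apply: nF; exists k.
Qed.

End supermartingale_criterion.

Lemma jump_time_ge (R : realType) (T : Type) (H : nat -> T -> R) (w : T) m n :
  (forall n w, 0 < H n w) -> (m <= n)%N -> jump_time H m w <= jump_time H n w.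
Proof.
move=> H0 /subnKC <-; elim: (n - m)%N => [|k IH]; first by rewrite addn0.
by rewrite addnS /jump_time big_ord_recr/= (le_trans IH)// lerDl ltW.
Qed.

(** After the last visit of the jump chain to [x], at step [n - 1] or earlier,
    the process itself is away from [x] from the [n]-th jump time on. *)
Lemma geometric_drift_transient (R : realType) (S : countType)
    (q : S -> S -> R) (g : S -> R) (rho : R)
    (d : measure_display) (T : measurableType d)
    (P : S -> probability T R) (X : R -> T -> option S) :
  (forall x y, 0 <= q x y) -> (forall x, 0 <= exit_rate q x) ->
  (forall x, 0 < g x) -> 0 < rho -> rho < 1 ->
  (forall x, (\esum_(y in [set: S]) (q x y / exit_rate q x * g y)%:E <=
              (rho * g x)%:E)%E) ->
  markov_chain q P X -> transient P X.
Proof.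
move=> q0 e0 g0 rho0 rho1 drift chainX x.
have [Y [H [mY _ H0 law XE]]] := chainX x.
apply: filterS (ae_finitely_many_visits q0 e0 g0 rho0 rho1 drift mY H0 law x).
move=> w [n nY]; exists (jump_time H n w) => t [t0 /(XE _ _ _ t0)].
move=> [k [/andP[_ tk] Yk]]; apply/ltW/(lt_le_trans tk)/jump_time_ge => //.
by rewrite ltnNge; apply/negP => nk; exact: (nY k nk Yk).
Qed.

(** * An elementary bound on the exponential *)

(** Comes from [1 - u <= expR (- u)], hence [expR u <= 1 / (1 - u)]. *)
Lemma expR_le_quad (R : realType) (u : R) :
  u <= 2^-1 -> expR u <= 1 + u + 2 * u ^+ 2.
Proof.
move=> u2; have u1 : 0 < 1 - u by lra.
have le1 : (1 - u) * expR u <= 1.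
  rewrite -[leRHS](expRxMexpNx_1 u) mulrC; apply: ler_wpM2l.
    exact: expR_ge0.
  exact: expR_ge1Dx.
rewrite -(ler_pM2l u1); apply: le_trans le1 _.
have : 0 <= u ^+ 2 * (1 - 2 * u) by rewrite mulr_ge0 ?sqr_ge0//; lra.
by lra.
Qed.

(** * Rates of the small jump model *)

Lemma small_jump_rate_ge0 (R : realType) (N : nat) (delta lambda : R) x y :
  0 <= delta -> 0 <= lambda -> 0 <= @small_jump_rate R N delta lambda x y.
Proof.
move=> d0 l0; apply: sumr_ge0 => i _; rewrite addr_ge0//; case: ifP => // _.
  exact: addr_ge0.
by rewrite addr_ge0// !mulr_ge0// ?invr_ge0// sumr_ge0.
Qed.

Section small_jump.
Variables (R : realType) (N : nat) (delta lambda : R).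
Hypothesis delta_ge0 : 0 <= delta.
Hypothesis lambda_ge0 : 0 <= lambda.
Implicit Types (x y : {ffun 'I_N -> nat}) (i k : 'I_N).

Definition num_below x i : nat := (\sum_k (x k < x i))%N.

(** The value [0] at the bottom lets a particle at height [0] be treated like
    the others: its fictitious downward jump has rate [0]. *)
Definition down_rate x i : R :=
  if (0 < x i)%N then 1 + lambda * (N%:R^-1 * (num_below x i)%:R) else 0.

Lemma down_rate_ge0 x i : 0 <= down_rate x i.
Proof.
rewrite /down_rate; case: ifP => // _.
by rewrite addr_ge0// mulr_ge0// mulr_ge0// ?invr_ge0.
Qed.

(** All sums over successor states reduce to this one: [h = 1] gives the exit
    rate, and [h] a Lyapunov function over the exit rate gives one step of the
    jump chain. *)
Lemma esum_small_jump (D : set {ffun 'I_N -> nat})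
    (h : {ffun 'I_N -> nat} -> R) x :
  (forall i, D (incr x i)) -> (forall i, (0 < x i)%N -> D (decr x i)) ->
  (forall y, 0 <= h y) ->
  \esum_(y in D) (small_jump_rate delta lambda x y * h y)%:E =
  (\sum_i ((1 + delta) * h (incr x i) + down_rate x i * h (decr x i)))%:E.
Proof.
move=> Dincr Ddecr h0.
pose a i y : R :=
  if true && (y == incr x i) then (1 + delta) * h (incr x i) else 0.
pose b i y : R := if (0 < x i)%N && (y == decr x i)
                  then down_rate x i * h (decr x i) else 0.
have a0 i y : 0 <= a i y.
  by rewrite /a; case: ifP => // _; rewrite mulr_ge0// addr_ge0.
have b0 i y : 0 <= b i y.
  by rewrite /b; case: ifP => // _; rewrite mulr_ge0// down_rate_ge0.
transitivity (\esum_(y in D) \sum_i ((a i y)%:E + (b i y)%:E)%E).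
  apply: eq_esum => y _; rewrite /small_jump_rate mulr_suml -sumEFin.
  apply: eq_bigr => i _; rewrite -EFinD mulrDl; congr (_ + _)%:E.
    by rewrite /a/=; case: eqVneq => [->|_]//; rewrite mul0r.
  rewrite /b /down_rate; case: ifP => [/andP[-> /eqP ->]|_];
    last by rewrite mul0r.
  by rewrite /num_below natr_sum.
rewrite esum_sum; last by move=> *; rewrite adde_ge0// lee_fin.
rewrite -sumEFin; apply: eq_bigr => i _.
rewrite esumD; [|by move=> *; rewrite lee_fin..].
rewrite EFinD /a /b !esum_point//.
- by rewrite /down_rate; case: ifP => [->//|_]; rewrite mul0r.
- by rewrite mulr_ge0// down_rate_ge0.
- exact: Ddecr.
- by rewrite mulr_ge0// addr_ge0.
Qed.

Lemma exit_small_jump x :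
  exit_rate (small_jump_rate delta lambda) x =
  \sum_i (1 + delta + down_rate x i).
Proof.
rewrite /exit_rate.
under eq_esum do rewrite -[small_jump_rate _ _ _ _]mulr1.
rewrite (@esum_small_jump _ (fun=> 1))//=.
- by under eq_bigr do rewrite !mulr1.
- move=> i; apply/eqP => /ffunP /(_ i); rewrite ffunE eqxx => /eqP.
  by rewrite eqn_leq ltnn.
- move=> i xi; apply/eqP => /ffunP /(_ i); rewrite ffunE eqxx => /eqP.
  by case: (x i) xi => // n _ /=; rewrite eqn_leq ltnn andbF.
Qed.

(** * The lowest particles *)

Variable i0 : 'I_N.

Definition lowest x : nat := x [arg min_(i < i0) x i].

Lemma lowest_le x i : (lowest x <= x i)%N.
Proof. by rewrite /lowest; case: arg_minnP => // j _; apply. Qed.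

Lemma le_lowest x v : (forall i, (v <= x i)%N) -> (v <= lowest x)%N.
Proof. by move=> h; exact: h. Qed.

Definition sole_min x i : bool := [forall k, (k != i) ==> (x i < x k)%N].
Definition is_min x i : bool := x i == lowest x.
Definition num_min x : nat := (\sum_i is_min x i)%N.

Lemma lowest_incr x i : (lowest x + sole_min x i <= lowest (incr x i))%N.
Proof.
apply: le_lowest => k; rewrite ffunE; have [->|ki] := eqVneq k i.
  by have := lowest_le x i; case: sole_min; lia.
case: (boolP (sole_min x i)) => [/forallP/(_ k)|_]; last first.
  by rewrite addn0 lowest_le.
by rewrite ki/= addn1; apply: leq_ltn_trans; exact: lowest_le.
Qed.

Lemma lowest_decr x i : (0 < x i)%N ->
  (lowest x <= lowest (decr x i) + is_min x i)%N.
Proof.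
move=> xi; suff : (lowest x - is_min x i <= lowest (decr x i))%N by lia.
apply: le_lowest => k; rewrite ffunE; have := lowest_le x k.
have [->|_] := eqVneq k i; last by lia.
by rewrite /is_min; case: eqVneq => /=; lia.
Qed.

Lemma num_min_gt0 x : (0 < num_min x)%N.
Proof. by rewrite /num_min (bigD1 [arg min_(i < i0) x i])//= /is_min eqxx. Qed.

Lemma num_min1_sole_min x : num_min x = 1%N -> (0 < \sum_i sole_min x i)%N.
Proof.
pose j := [arg min_(i < i0) x i].
rewrite /num_min (bigD1 j)//= {1}/is_min eqxx => -[/eqP].
rewrite sum_nat_eq0 => /forallP nmin.
rewrite (bigD1 j)//= (_ : sole_min x j)//.
apply/forallP => k; apply/implyP => kj; have := nmin k; rewrite kj/= eqb0.
by rewrite ltn_neqAle eq_sym => ->; exact: lowest_le.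
Qed.

Lemma num_below_min x i : is_min x i -> num_below x i = 0%N.
Proof.
move=> /eqP xi; rewrite /num_below big1// => k _.
by rewrite xi ltnNge lowest_le.
Qed.

(** Twice the sum counts the ordered pairs at distinct heights.  The other
    ordered pairs include the [N] diagonal ones and the off-diagonal ones among
    the [m] lowest particles, [m ^ 2 - m] in number. *)
Lemma sum_num_below_le x :
  (2 * (\sum_i num_below x i) + num_min x * num_min x + N <=
   N * N + num_min x)%N.
Proof.
have tot : (\sum_(i < N) \sum_(k < N)
    ((x k < x i) + (x i < x k) + (x i == x k)) = N * N)%N.
  have one i k : ((x k < x i) + (x i < x k) + (x i == x k) = 1)%N.
    by case: ltngtP.
  under eq_bigr do under eq_bigr do rewrite one.
  by rewrite !sum_nat_const !card_ord muln1.
have sym : (\sum_(i < N) \sum_(k < N) (x i < x k) = \sum_i num_below x i)%N.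
  by rewrite exchange_big.
have eqs : (\sum_i (num_min x * is_min x i + ~~ is_min x i) <=
    \sum_(i < N) \sum_(k < N) (x i == x k))%N.
  apply: leq_sum => i _; case: (boolP (is_min x i)) => [/eqP xi|_] /=.
    rewrite muln1 addn0; apply: leq_sum => k _.
    by rewrite /is_min xi eq_sym.
  by rewrite muln0 (bigD1 i)//= eqxx.
have cmin : (num_min x + \sum_i ~~ is_min x i = N)%N.
  have one i : (is_min x i + ~~ is_min x i = 1)%N by case: is_min.
  rewrite /num_min -big_split/=; under eq_bigr do rewrite one.
  by rewrite sum_nat_const card_ord muln1.
have {}tot : (2 * (\sum_i num_below x i) +
    \sum_(i < N) \sum_(k < N) (x i == x k) = N * N)%N.
  rewrite -tot mul2n -addnn -{2}sym /num_below -!big_split/=.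
  by apply: eq_bigr => i _; rewrite -!big_split.
move: eqs; rewrite big_split/= -big_distrr/= -/(num_min x); move: cmin tot.
move: (num_min x) (\sum_i num_below x i)%N (\sum_i ~~ is_min x i)%N
  (\sum_(i < N) _)%N.
lia.
Qed.

(** * The Lyapunov function and its drift *)

Variable c : R.
Hypothesis c_ge0 : 0 <= c.

Definition lyapunov x : R := \sum_i (x i)%:R + c * (lowest x)%:R.

Lemma lyapunov_incr x i :
  lyapunov x + (1 + c * (sole_min x i)%:R) <= lyapunov (incr x i).
Proof.
have -> : lyapunov (incr x i) =
    \sum_i (x i)%:R + 1 + c * (lowest (incr x i))%:R.
  congr (_ + _); rewrite (bigD1 i)//= [in RHS](bigD1 i)//= ffunE eqxx.
  rewrite -[in LHS]natr1 -!addrA; congr (_ + _); rewrite addrC; congr (_ + _).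
  by apply: eq_bigr => k ki; rewrite ffunE (negbTE ki).
have := lowest_incr x i; rewrite -(ler_nat R) natrD => /(ler_wpM2l c_ge0).
by rewrite /lyapunov; lra.
Qed.

Lemma lyapunov_decr x i : (0 < x i)%N ->
  lyapunov x - (1 + c * (is_min x i)%:R) <= lyapunov (decr x i).
Proof.
move=> xi; have -> : lyapunov (decr x i) =
    \sum_i (x i)%:R - 1 + c * (lowest (decr x i))%:R.
  congr (_ + _); rewrite (bigD1 i)//= [in RHS](bigD1 i)//= ffunE eqxx.
  rewrite -[in RHS](prednK xi) -[in RHS]natr1 addrAC addrK; congr (_ + _).
  by apply: eq_bigr => k ki; rewrite ffunE (negbTE ki).
have := lowest_decr xi; rewrite -(ler_nat R) natrD => /(ler_wpM2l c_ge0).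
by rewrite /lyapunov; lra.
Qed.

(** A lower bound for the generator applied to [lyapunov], built from the
    bounds on its increments in [lyapunov_incr] and [lyapunov_decr]. *)
Definition drift x : R :=
  \sum_i ((1 + delta) * (1 + c * (sole_min x i)%:R) -
          down_rate x i * (1 + c * (is_min x i)%:R)).

(** With [m] lowest particles and [U] the number of sole lowest ones, the bound
    amounts to [(1 + delta) * U + (2 + delta) * (m ^ 2 - m) / 2 >= m + delta],
    with equality for [m = U = 1] and for [m = 2], [U = 0]. *)
Lemma drift_ge x : lambda / N%:R = c * (2 + delta) ->
  N%:R * delta - lambda * (N%:R - 1) / 2 + c * delta <= drift x.
Proof.
move=> cE.
have N0 : N%:R != 0 :> R.
  by rewrite pnatr_eq0 -lt0n (leq_ltn_trans _ (ltn_ord i0)).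
pose U := (\sum_i sole_min x i)%N; pose L := (\sum_i num_below x i)%N.
have step : N%:R * delta + c * (1 + delta) * U%:R - lambda / N%:R * L%:R
    - c * (num_min x)%:R <= drift x.
  have -> : N%:R * delta = \sum_(i < N) delta.
    by rewrite sumr_const card_ord mulr_natl.
  rewrite /U /L /num_min !natr_sum !mulr_sumr -big_split/= -!sumrB.
  apply: ler_sum => i _.
  have le_down : down_rate x i * (1 + c * (is_min x i)%:R) <=
      1 + lambda / N%:R * (num_below x i)%:R + c * (is_min x i)%:R.
    rewrite /down_rate -mulrA; case: ifP => _.
      case: (boolP (is_min x i)) => [mi|_]; last by rewrite mulr0 !addr0 mulr1.
      by rewrite num_below_min//= !mulr0 !addr0 mul1r.
    by rewrite mul0r !addr_ge0// mulr_ge0// mulr_ge0// invr_ge0.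
  by move: le_down; lra.
apply: le_trans step.
have lamE : lambda = c * (2 + delta) * N%:R by rewrite -cE divfK.
have := sum_num_below_le x; rewrite -(ler_nat R) !natrD !natrM -/L => Lle.
have m0 := num_min_gt0 x; have m1 := @num_min1_sole_min x; rewrite -/U in m1.
rewrite cE {1}lamE.
have cd0 : 0 <= c * (2 + delta) by rewrite mulr_ge0// addr_ge0.
have cL : c * (2 + delta) * (2 * L%:R) <= c * (2 + delta) *
    (N%:R * N%:R + (num_min x)%:R - (num_min x)%:R * (num_min x)%:R - N%:R).
  by apply: ler_wpM2l => //; lra.
suff : 0 <= c * ((1 + delta) * U%:R + (2 + delta) *
    ((num_min x)%:R * (num_min x)%:R - (num_min x)%:R) / 2 -
    (num_min x)%:R - delta).
  by move: cL; lra.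
apply: mulr_ge0 => //.
have [me|mn1] := eqVneq (num_min x) 1%N.
  have U1 : 1 <= U%:R :> R by rewrite (ler_nat _ 1) m1.
  have : 0 <= (1 + delta) * (U%:R - 1) by rewrite mulr_ge0 ?subr_ge0// addr_ge0.
  by rewrite me; lra.
have m2 : 2 <= (num_min x)%:R :> R by rewrite (ler_nat _ 2); lia.
have U0 : 0 <= U%:R :> R by [].
have dU0 : 0 <= (1 + delta) * U%:R by rewrite mulr_ge0// addr_ge0.
have dm : 0 <= ((num_min x)%:R - 2) * (num_min x)%:R :> R.
  by rewrite mulr_ge0// subr_ge0.
have dm2 : 0 <= delta * (((num_min x)%:R - 2) * ((num_min x)%:R + 1)).
  by rewrite !mulr_ge0// ?subr_ge0// addr_ge0.
by move: dU0 dm dm2; lra.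
Qed.

(** * Exponential contraction *)

Lemma down_rate_le x i : down_rate x i <= 1 + lambda.
Proof.
rewrite /down_rate; case: ifP => _; last by rewrite addr_ge0.
have N0 : (0 < N)%N := leq_ltn_trans (leq0n _) (ltn_ord i).
rewrite lerD2l -[leRHS]mulr1 ler_wpM2l// ler_pdivrMl ?ltr0n// mulr1 ler_nat.
rewrite -[leqRHS]card_ord -sum1_card /num_below.
by apply: leq_sum => k _; case: (x k < x i)%N.
Qed.

Lemma exit_small_jump_gt0 x : 0 < exit_rate (small_jump_rate delta lambda) x.
Proof.
rewrite exit_small_jump (bigD1 i0)//= ltr_pwDl//.
  by rewrite ltr_pwDl ?down_rate_ge0// ltr_pwDl.
by apply: sumr_ge0 => i _; rewrite !addr_ge0 ?down_rate_ge0.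
Qed.

Lemma exit_small_jump_le x :
  exit_rate (small_jump_rate delta lambda) x <= N%:R * (2 + delta + lambda).
Proof.
rewrite exit_small_jump -[X in X%:R]card_ord -sumr_const mulr_suml.
apply: ler_sum => i _; have := down_rate_le x i; lra.
Qed.

(** The increment enters through a lower bound [a] only, since the exponential
    is decreasing in [lyapunov]. *)
Lemma exp_lyapunov_le theta x y a : 0 <= theta -> theta * (1 + c) <= 2^-1 ->
  `|a| <= 1 + c -> lyapunov x + a <= lyapunov y ->
  expR (- (theta * lyapunov y)) <=
  expR (- (theta * lyapunov x)) * (1 - theta * a + 2 * (theta * (1 + c)) ^+ 2).
Proof.
move=> t0 t1 ab xy.
have tab : `|theta * a| <= theta * (1 + c).
  by rewrite normrM ger0_norm// ler_wpM2l.
apply: (@le_trans _ _ (expR (- (theta * lyapunov x)) * expR (- (theta * a)))).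
  rewrite -expRD ler_expR -opprD lerN2 -mulrDr; exact: ler_wpM2l.
rewrite ler_wpM2l ?expR_ge0//.
apply: le_trans (expR_le_quad _) _.
  by apply: le_trans t1; apply: le_trans tab; rewrite -normrN ler_norm.
rewrite lerD2l ler_wpM2l// sqrrN -real_normK ?num_real//.
by rewrite ler_pXn2r ?nnegrE// (le_trans _ tab).
Qed.

(** Relative to [g x * exit_rate x], the expectation after one
    jump is at most
    [1 - theta * drift x / exit_rate x + 2 * (theta * (1 + c)) ^ 2], where
    [1 + c] bounds the jumps of [lyapunov].  Bounding the exit rate by [M] and
    minimising over [theta] gives [theta * (1 + c) = r / 4] and
    [rho = 1 - r ^ 2 / 8], with [r = A / ((1 + c) * M)]. *)
Lemma exp_lyapunov_contraction (A : R) : 0 < A -> (forall x, A <= drift x) ->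
  exists theta rho : R, [/\ 0 < rho, rho < 1 & forall x,
    (\esum_(y in [set: {ffun 'I_N -> nat}])
      (small_jump_rate delta lambda x y /
       exit_rate (small_jump_rate delta lambda) x *
       expR (- (theta * lyapunov y)))%:E <=
     (rho * expR (- (theta * lyapunov x)))%:E)%E].
Proof.
move=> A0 Adrift.
pose M := N%:R * (2 + delta + lambda).
pose r := A / ((1 + c) * M).
have b1 : 1 <= 1 + c by rewrite lerDl.
have M0 : 0 < M :=
  lt_le_trans (exit_small_jump_gt0 [ffun=> 0%N]) (exit_small_jump_le _).
have b0 : 0 < 1 + c := lt_le_trans ltr01 b1.
(* The drift is at most the largest jump times the exit rate. *)
have AM : A <= (1 + c) * M.
  apply: le_trans (Adrift [ffun=> 0%N]) _.
  apply: le_trans (ler_wpM2l (ltW b0) (exit_small_jump_le [ffun=> 0%N])).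
  rewrite exit_small_jump mulr_sumr; apply: ler_sum => i _.
  have d0 := down_rate_ge0 [ffun=> 0%N] i.
  have : 0 <= (1 + delta) * (c * (1 - (sole_min [ffun=> 0%N] i)%:R)).
    apply: mulr_ge0; first exact: addr_ge0.
    by rewrite mulr_ge0// subr_ge0 lern1 leq_b1.
  have : 0 <= down_rate [ffun=> 0%N] i * (c * (is_min [ffun=> 0%N] i)%:R).
    by rewrite !mulr_ge0.
  have : 0 <= down_rate [ffun=> 0%N] i * c by rewrite mulr_ge0.
  by move: d0; lra.
have r0 : 0 < r by rewrite divr_gt0// mulr_gt0.
have r1 : r <= 1 by rewrite ler_pdivrMr ?mul1r// mulr_gt0.
pose theta := r / (4 * (1 + c)).
have thE : theta * (1 + c) = r / 4 by rewrite /theta; field; rewrite gt_eqF.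
have th0 : 0 <= theta by rewrite divr_ge0 ?ltW// mulr_gt0.
exists theta, (1 - r ^+ 2 / 8); split.
- have : r ^+ 2 <= 1 by rewrite expr_le1// ltW.
  by lra.
- by have : 0 < r ^+ 2 by [rewrite exprn_gt0]; lra.
move=> x; set E := exit_rate _ x.
have E0 : 0 < E := exit_small_jump_gt0 x.
pose g y := expR (- (theta * lyapunov y)).
under eq_esum => y _ do rewrite mulrAC -mulrA.
rewrite (@esum_small_jump _ (fun y => g y / E))//; last first.
  by move=> y; rewrite divr_ge0 ?expR_ge0// ltW.
rewrite lee_fin.
have -> : \sum_i ((1 + delta) * (g (incr x i) / E) +
                  down_rate x i * (g (decr x i) / E))
  = (\sum_i ((1 + delta) * g (incr x i) + down_rate x i * g (decr x i))) / E.
  by rewrite mulr_suml; apply: eq_bigr => i _; ring.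
rewrite ler_pdivrMr//.
have th2 : theta * (1 + c) <= 2^-1 by rewrite thE; lra.
have bnd (b : bool) : `|1 + c * b%:R| <= 1 + c.
  rewrite ger0_norm ?addr_ge0 ?mulr_ge0// lerD2l.
  by case: b; rewrite ?mulr1// mulr0.
apply: (@le_trans _ _ (g x * (E * (1 + 2 * (r / 4) ^+ 2) - theta * drift x))).
  rewrite /E exit_small_jump /drift mulr_suml [theta * _]mulr_sumr.
  rewrite -sumrB mulr_sumr.
  apply: ler_sum => i _.
  have up : (1 + delta) * g (incr x i) <=
      (1 + delta) *
        (g x * (1 - theta * (1 + c * (sole_min x i)%:R) + 2 * (r / 4) ^+ 2)).
    apply: ler_wpM2l; first exact: addr_ge0.
    by rewrite -thE; apply: exp_lyapunov_le => //; exact: lyapunov_incr.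
  have dn : down_rate x i * g (decr x i) <=
      down_rate x i *
        (g x * (1 + theta * (1 + c * (is_min x i)%:R) + 2 * (r / 4) ^+ 2)).
    case: (ltnP 0 (x i)) => xi; last by rewrite /down_rate ltnNge xi !mul0r.
    apply: ler_wpM2l; first exact: down_rate_ge0.
    rewrite -thE -[theta * (1 + _ * _)]opprK -mulrN.
    apply: exp_lyapunov_le => //; first by rewrite normrN.
    exact: lyapunov_decr.
  by move: up dn; lra.
rewrite -/(g x) [leRHS](_ : _ = g x * (E * (1 - r ^+ 2 / 8))); last by ring.
apply: ler_wpM2l; first exact: expR_ge0.
have : theta * (E * (A / M)) <= theta * drift x.
  apply: ler_wpM2l => //; apply: le_trans (Adrift x).
  rewrite mulrCA ler_piMr ?(ltW A0)// ler_pdivrMr// mul1r.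
  exact: exit_small_jump_le.
have -> : theta * (E * (A / M)) = E * (r ^+ 2 / 4).
  by rewrite /theta /r; field; rewrite !gt_eqF.
lra.
Qed.

End small_jump.

(** * The threshold *)

Lemma eps_denominator_gt0 (R : realType) (delta n : R) :
  0 <= delta -> 2 <= n -> 0 < n * (n - 1) * (delta + 2) - 2 * delta.
Proof.
move=> d0 n2; have nn2 : 2 <= n * (n - 1) by nra.
have : 2 * (delta + 2) <= n * (n - 1) * (delta + 2).
  by apply: ler_wpM2r => //; lra.
by lra.
Qed.

(** [eps delta n] is nonnegative and of order [1 / n]; the constant [4] works
    from [n = 4] on. *)
Lemma eps_cvg0 (R : realType) (delta : R) : 0 <= delta ->
  eps delta n @[n --> \oo] --> (0 : R).
Proof.
move=> d0.
have h4 : 4 * harmonic n @[n --> \oo] --> (0 : R).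
  by rewrite -[X in _ --> X](mulr0 4); apply: cvgMr => //; exact: cvg_harmonic.
apply: squeeze_cvgr (cvg_cst 0) h4.
exists 4%N => // n /= n4; rewrite /eps.
have N4 : 4 <= n%:R :> R by rewrite ler_nat.
set m : R := n%:R in N4 *; have N2 : 2 <= m by lra.
have D0 := eps_denominator_gt0 d0 N2.
rewrite /harmonic -natr1 -/m.
have -> : m ^+ 2 * (delta + 2) / (m * (m - 1) * (delta + 2) - 2 * delta) - 1
  = (m * (delta + 2) + 2 * delta) / (m * (m - 1) * (delta + 2) - 2 * delta).
  by field; rewrite gt_eqF.
apply/andP; split; first by rewrite divr_ge0 ?(ltW D0)//; nra.
rewrite ler_pdivrMr// mulrAC ler_pdivlMr; last lra.
nra.
Qed.

(** Multiplying by [2 * N * (2 + delta)] turns the conclusion into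
    [lambda * (N * (N - 1) * (delta + 2) - 2 * delta)
     < 2 * delta * N ^ 2 * (delta + 2)], which is the hypothesis with its
    denominator cleared. *)
Lemma drift_bound_gt0 (R : realType) (N : nat) (delta lambda : R) :
  (2 <= N)%N -> 0 <= delta -> lambda < (1 + eps delta N) * (2 * delta) ->
  0 < N%:R * delta - lambda * (N%:R - 1) / 2 +
      lambda / N%:R / (2 + delta) * delta.
Proof.
move=> hN d0; have : 2 <= N%:R :> R by rewrite ler_nat.
rewrite /eps; set n : R := N%:R => n2.
have D0 := eps_denominator_gt0 d0 n2.
rewrite addrC subrK -subr_gt0.
rewrite (_ : _ - lambda = (2 * n * (delta + 2)) /
   (n * (n - 1) * (delta + 2) - 2 * delta) *
   (n * delta - lambda * (n - 1) / 2 + lambda / n / (2 + delta) * delta)).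
  rewrite pmulr_rgt0// divr_gt0//; nra.
by field; rewrite !gt_eqF//; lra.
Qed.

Theorem theorem2 (R : realType) (N : nat) (delta lambda : R)
    (hN : (2 <= N)%N) (hdelta : 0 <= delta) (hlambda : 0 <= lambda) :
  (eps delta n @[n --> \oo] --> (0 : R)) /\
  (lambda < (1 + eps delta N) * (2 * delta) ->
   forall (d : measure_display) (T : measurableType d)
     (P : {ffun 'I_N -> nat} -> probability T R)
     (X : R -> T -> option {ffun 'I_N -> nat}),
   markov_chain (small_jump_rate delta lambda) P X ->
   transient P X).
Proof.
split; first exact: eps_cvg0.
move=> hlam d T P X chainX.
pose i0 : 'I_N := Ordinal (ltnW hN).
pose c := lambda / N%:R / (2 + delta).
have d2 : 0 < 2 + delta by rewrite ltr_pwDl.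
have c0 : 0 <= c by rewrite !divr_ge0// ltW.
have cE : lambda / N%:R = c * (2 + delta) by rewrite /c divfK// gt_eqF.
have [theta [rho [rho0 rho1 contr]]] :=
  exp_lyapunov_contraction hdelta hlambda c0 (drift_bound_gt0 hN hdelta hlam)
    (fun x => drift_ge hdelta hlambda i0 c0 x cE).
apply: (geometric_drift_transient _ _ _ rho0 rho1 contr chainX).
- by move=> x y; exact: small_jump_rate_ge0.
- by move=> x; exact/ltW/exit_small_jump_gt0.
- by move=> x; exact: expR_gt0.
Qed.
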